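(* Let $\Bbbk$ be an uncountable algebraically closed field of characteristic zero, and let $(R,\mathfrak{m},\Bbbk)$ be a $0$-dimensional standard graded Cohen-Macaulay ring with $R_0=\Bbbk$. Then the following are equivalent: (1) $R$ is of graded finite Cohen-Macaulay type; (2) $R$ is of graded countable Cohen-Macaulay type; (3) $R$ is a hypersurface ring.
   Context: A ring $R$ is standard graded if it is Noetherian and, as an abelian group, $R=\bigoplus_{i\geqslant 0}R_i$ with $R_iR_j\subseteq R_{i+j}$ for all $i,j\geqslant 0$, $R_0$ is a field, and $R=R_0[R_1]$. Write $\mathfrak{m}=\bigoplus_{i\geqslant 1}R_i$ for the irrelevant maximal ideal and $\Bbbk=R_0=R/\mathfrak{m}$. A standard graded Cohen-Macaulay ring has graded finite (respectively, graded countable) Cohen-Macaulay type if it has only finitely many (respectively, at most countably many) indecomposable graded maximal Cohen-Macaulay modules (finitely generated), up to graded isomorphism and shift in degree. A hypersurface ring is a standard graded ring isomorphic to a polynomial ring over $\Bbbk$ (variables of degree one) modulo an ideal generated by one homogeneous element; in dimension zero this means $R\cong\Bbbk[x]/(x^m)$ for some $m\geqslant 1$. *)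

(* Defs.v *)
From HB Require Import structures.
From mathcomp Require Import all_boot all_order all_algebra.
From mathcomp Require Import boolp classical_sets functions cardinality.
From mathcomp Require Import mpoly.

Set Implicit Arguments.
Unset Strict Implicit.
Unset Printing Implicit Defensive.

Import GRing.Theory.

Local Open Scope ring_scope.
Local Open Scope classical_set_scope.

Definition internal_direct_sum (I : choiceType) (V : zmodType)
    (A : I -> {pred V}) : Prop :=
  [/\ forall i, GRing.zmod_closed (A i),
      forall x, exists (s : seq I) (f : I -> V),
        [/\ uniq s, forall i, f i \in A i & x = \sum_(i <- s) f i]
    & forall (s : seq I) (f : I -> V), uniq s -> (forall i, f i \in A i) ->
        \sum_(i <- s) f i = 0 -> forall i, i \in s -> f i = 0].

Definition span (R : pzRingType) (V : lmodType R) (s : seq V) : set V :=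
  [set x | exists c : nat -> R, x = \sum_(i < size s) c i *: s`_i].

Definition fin_gen (R : pzRingType) (V : lmodType R) : Prop :=
  exists s : seq V, forall x, span s x.

(* The ideals of R are the submodules of the regular module R^o. *)
Definition noetherian (R : comNzRingType) : Prop :=
  forall I : {pred R^o}, GRing.submod_closed I ->
    exists s : seq R^o, forall x, x \in I <-> span s x.

(* [idealr_closed] includes properness. *)
Definition prime_ideal (R : comNzRingType) (P : {pred R}) : Prop :=
  idealr_closed P /\ prime_idealr_closed P.

Definition has_prime_chain (R : comNzRingType) (n : nat) : Prop :=
  exists P : nat -> {pred R},
    (forall i, (i <= n)%N -> prime_ideal (P i)) /\
    (forall i, (i < n)%N ->
       {subset P i <= P i.+1} /\ ~ {subset P i.+1 <= P i}).

Definition krull_dim (R : comNzRingType) (d : nat) : Prop :=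
  has_prime_chain R d /\ forall n, has_prime_chain R n -> (n <= d)%N.

Definition standard_graded (R : comNzRingType) (G : nat -> {pred R}) : Prop :=
  [/\ noetherian R,
      internal_direct_sum G,
      forall i j x y, x \in G i -> y \in G j -> x * y \in G (i + j)%N,
      1 \in G 0%N /\
      (forall x, x \in G 0%N -> x != 0 -> exists2 y, y \in G 0%N & x * y = 1)
    & forall S : {pred R}, GRing.subring_closed S ->
        {subset G 0%N <= S} -> {subset G 1%N <= S} -> forall x, x \in S].

Definition irrelevant_ideal (R : comNzRingType) (G : nat -> {pred R}) : set R :=
  [set x | exists (s : seq nat) (f : nat -> R),
     [/\ 0%N \notin s, forall i, f i \in G i & x = \sum_(i <- s) f i]].

(* The submodule (s)V of V, for (s) the ideal generated by s. *)
Definition ideal_smul (R : comNzRingType) (V : lmodType R) (s : seq R) :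
    set V :=
  [set x | exists w : nat -> V, x = \sum_(i < size s) s`_i *: w i].

(* Nonzerodivisors on V / (s_0, ..., s_(i-1))V, with V <> (s)V. *)
Definition regular_seq (R : comNzRingType) (V : lmodType R) (s : seq R) :
    Prop :=
  (forall i, (i < size s)%N -> forall u : V,
     ideal_smul (take i s) (s`_i *: u) -> ideal_smul (take i s) u) /\
  (exists u : V, ~ ideal_smul s u).

(* Grade of the irrelevant ideal m on V; no d satisfies [depth G V d] when V = 0. *)
Definition depth (R : comNzRingType) (G : nat -> {pred R}) (V : lmodType R)
    (d : nat) : Prop :=
  let regular_in_m s :=
    (forall x, x \in s -> irrelevant_ideal G x) /\ regular_seq V s in
  (exists2 s, regular_in_m s & size s = d) /\
  (forall s, regular_in_m s -> (size s <= d)%N).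

Definition cohen_macaulay (R : comNzRingType) (G : nat -> {pred R}) : Prop :=
  exists2 d, krull_dim R d & depth G R^o d.

Record graded_module (R : comNzRingType) (G : nat -> {pred R}) := GradedModule {
  gm_sort :> lmodType R;
  gm_comp : int -> {pred gm_sort};
  gm_direct : internal_direct_sum gm_comp;
  gm_scale : forall (i : nat) (j : int) (a : R) (u : gm_sort),
    a \in G i -> u \in gm_comp j -> a *: u \in gm_comp (i%:Z + j)
}.
Arguments gm_comp {R G} M _ : rename.

Definition graded_submodule (R : comNzRingType) (G : nat -> {pred R})
    (M : graded_module G) (N : {pred M}) : Prop :=
  GRing.submod_closed N /\
  forall (s : seq int) (f : int -> M), uniq s ->
    (forall i, f i \in gm_comp M i) ->
    \sum_(i <- s) f i \in N -> forall i, i \in s -> f i \in N.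

Definition gm_indecomposable (R : comNzRingType) (G : nat -> {pred R})
    (M : graded_module G) : Prop :=
  (exists x : M, x != 0) /\
  forall N1 N2 : {pred M}, graded_submodule N1 -> graded_submodule N2 ->
    (forall x, exists u v, [/\ u \in N1, v \in N2 & x = u + v]) ->
    (forall x, x \in N1 -> x \in N2 -> x = 0) ->
    (forall x, x \in N1 -> x = 0) \/ (forall x, x \in N2 -> x = 0).

Definition maximal_cohen_macaulay (R : comNzRingType) (G : nat -> {pred R})
    (M : graded_module G) : Prop :=
  fin_gen M /\ exists2 d, krull_dim R d & depth G M d.

Definition gm_shift_iso (R : comNzRingType) (G : nat -> {pred R})
    (M N : graded_module G) : Prop :=
  exists (n : int) (phi : {linear M -> N}), bijective phi /\
    forall i x, (x \in gm_comp M i) = (phi x \in gm_comp N (i + n)).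

(* Repetitions up to isomorphism and shift are allowed in F. *)
Definition lists_indecomposable_mcm (R : comNzRingType) (G : nat -> {pred R})
    (I : Type) (F : I -> graded_module G) : Prop :=
  (forall i, gm_indecomposable (F i) /\ maximal_cohen_macaulay (F i)) /\
  forall M : graded_module G, gm_indecomposable M -> maximal_cohen_macaulay M ->
    exists i, gm_shift_iso M (F i).

Definition graded_finite_CM_type (R : comNzRingType) (G : nat -> {pred R}) :
    Prop :=
  exists (I : finType) (F : I -> graded_module G), lists_indecomposable_mcm F.

Definition graded_countable_CM_type (R : comNzRingType) (G : nat -> {pred R}) :
    Prop :=
  exists (I : countType) (F : I -> graded_module G), lists_indecomposable_mcm F.

(* R ~ k[x_1, ..., x_n] / (f) as graded k-algebras, by a graded surjection phi
   whose kernel is (f). *)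
Definition hypersurface (k : fieldType) (R : comAlgType k)
    (G : nat -> {pred R}) : Prop :=
  exists (n d : nat) (f : {mpoly k[n]}) (phi : {lrmorphism {mpoly k[n]} -> R}),
    [/\ f \is d.-homog,
        forall y, exists p, phi p = y,
        forall p, phi p = 0 <-> exists q, p = q * f
      & forall e p, p \is e.-homog -> phi p \in G e].

(* Main.v *)
Require Import Defs.
From HB Require Import structures.
From mathcomp Require Import all_boot all_order all_algebra.
From mathcomp Require Import boolp classical_sets functions cardinality.
From mathcomp Require Import generic_quotient ring_quotient mpoly ring.

Set Implicit Arguments.
Unset Strict Implicit.
Unset Printing Implicit Defensive.

Import GRing.Theory.
Local Open Scope ring_scope.
Local Open Scope classical_set_scope.

(** Zero-dimensionality gives, for every [x], an equation
    [x ^+ n = r * x ^+ n.+1] ([krull_dim0_power]).  For [x] homogeneous of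
    positive degree a comparison of degrees turns it into [x ^+ n = 0].  So the
    irrelevant ideal consists of nilpotents, every nonzero module has depth 0,
    and the maximal Cohen-Macaulay modules are the nonzero finitely generated
    ones ([mcm_krull0]).

    Countable type forces [R_1] to be a line.  If [x], [y] in [R_1] are linearly
    independent, the modules [R / (y + c x)], for [c] in [k], are cyclic, hence
    indecomposable ([cyclic_indecomposable]), and their annihilators differ; a
    countable list of modules would make [k] countable ([countable_field]).
    Hence [R = k[x]] with [x] in [R_1] nilpotent, that is,
    [R = k[x] / (x ^+ e)] ([generator_hypersurface]).

    Conversely let [R = k[x_1, .., x_n] / (f)].  All variables are nilpotent in
    [R], so that [f] divides a power of each of them.  For [n >= 2] the leading
    monomial of [f] would then be 1 and [f] a unit; thus [n <= 1] and again
    [R = k[x]] with [x] nilpotent ([hypersurface_generator]).  Over such a ring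
    let [M] be an indecomposable graded module, [x ^+ e.+1] the first power of
    [x] that kills [M], and [u] a homogeneous element with [x ^+ e *: u != 0].
    A linear functional that does not vanish at [x ^+ e *: u] yields a graded
    complement of [R u] ([cyclic_summand]; this is the self-injectivity of
    [k[x] / (x ^+ e.+1)]).  So [M = R u], which is [R / (x ^+ e.+1)] up to a
    shift, and only finitely many [e] occur. *)

Definition set_pred (T : Type) (A : set T) : {pred T} := fun x => `[< A x >].

Lemma set_predP (T : Type) (A : set T) x : reflect (A x) (x \in set_pred A).
Proof. exact: asboolP. Qed.

(** The union of the empty chain is empty, whence the condition on nonempty
    chains only and the starting point [A0]. *)
Lemma exists_maximal_set (T : Type) (P : set T -> Prop) (A0 : set T) : P A0 ->
  (forall F : set (set T), F !=set0 -> F `<=` P -> total_on F subset ->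
     P (\bigcup_(X in F) X)) ->
  exists A, P A /\ forall B, A `<` B -> ~ P B.
Proof.
move=> PA0 Pchain; have [|A [[A_empty|PA] maxA]] :=
    @Zorn_bigcup _ (fun A => A = set0 \/ P A).
- move=> F FP Ftot; pose F' := [set X | F X /\ P X].
  have FF' : \bigcup_(X in F) X = \bigcup_(X in F') X.
    apply/seteqP; split=> x [X FX Xx]; last by exists X => //; case: FX.
    by exists X => //; split=> //; have [X0|//] := FP X FX; rewrite X0 in Xx.
  have [F'0|F'0] := pselect (F' !=set0); last first.
    by left; rewrite -subset0 FF' => x [X F'X _]; apply: F'0; exists X.
  right; rewrite FF'; apply: Pchain => // [X []//|X Y [FX _] [FY _]].
  exact: Ftot.
- have [A00|A00] := pselect (A0 = set0).
    exists A; split; first by rewrite A_empty -A00.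
    by move=> B /maxA nB PB; apply: nB; right.
  case: (maxA A0); last by right.
  by rewrite A_empty properEneq; split=> //; apply/eqP => E; apply: A00.
- by exists A; split=> // B /maxA nB PB; apply: nB; right.
Qed.

(** * Homogeneous components *)

Section Components.
Variables (I : choiceType) (V : zmodType) (A : I -> {pred V}).
Hypothesis dsA : internal_direct_sum A.

Lemma comp0 i : 0 \in A i. Proof. by have [/(_ i) []] := dsA. Qed.

Lemma compB i : {in A i &, forall x y, x - y \in A i}.
Proof. by have [/(_ i) []] := dsA. Qed.

Lemma compD i : {in A i &, forall x y, x + y \in A i}.
Proof.
move=> x y xA yA; rewrite -[y]opprK compB //.
by rewrite -sub0r compB // comp0.
Qed.

Lemma ex_decomposition x : exists p : seq I * (I -> V),
  [/\ uniq p.1, forall i, p.2 i \in A i & x = \sum_(i <- p.1) p.2 i].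
Proof.
by have [_ /(_ x) [s [f [us fA xE]]] _] := dsA; exists (s, f).
Qed.

(** A choice of homogeneous summands; [proj_sum] shows that it is irrelevant. *)
Definition decomposition x := sval (cid (ex_decomposition x)).

Definition proj i x : V :=
  if i \in (decomposition x).1 then (decomposition x).2 i else 0.

Lemma proj_in i x : proj i x \in A i.
Proof.
rewrite /proj /decomposition; case: cid => -[s f] /= [us fA xE].
by case: ifP => // _; exact: comp0.
Qed.

Lemma sum_widen (s u : seq I) (f : I -> V) : uniq s -> uniq u ->
  {subset s <= u} ->
  \sum_(i <- u) (if i \in s then f i else 0) = \sum_(i <- s) f i.
Proof.
move=> us uu su; rewrite -big_mkcond -big_filter; apply: perm_big.
apply: uniq_perm => [||i]; rewrite ?filter_uniq //.
by rewrite mem_filter; case: (boolP (i \in s)) => // /su.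
Qed.

(** Two decompositions of the same element, extended by zero to a common index
    set, have a difference that sums to 0; directness then makes them agree. *)
Lemma proj_sum (s : seq I) (f : I -> V) i : uniq s ->
  (forall j, f j \in A j) ->
  proj i (\sum_(j <- s) f j) = if i \in s then f i else 0.
Proof.
move=> us fA; rewrite /proj /decomposition; case: cid => -[t g] /= [ut gA E].
pose u := undup (s ++ t).
pose F j := (if j \in s then f j else 0) - (if j \in t then g j else 0).
have FA j : F j \in A j by rewrite /F compB //; case: ifP; rewrite ?comp0.
have F0 : \sum_(j <- u) F j = 0.
  rewrite sumrB !sum_widen ?undup_uniq ?E ?subrr // => j jst;
  by rewrite mem_undup mem_cat jst ?orbT.
have [_ _ /(_ u F (undup_uniq _) FA F0 i)] := dsA.
rewrite mem_undup mem_cat /F.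
case: (i \in s); case: (i \in t) => //= /(_ isT) /eqP;
by rewrite subr_eq0 => /eqP.
Qed.

Lemma proj_id i x : x \in A i -> proj i x = x.
Proof.
move=> xA; have := @proj_sum [:: i] (fun j => if j == i then x else 0) i isT.
rewrite big_seq1 eqxx inE eqxx; apply=> j.
by case: eqP => [->//|_]; exact: comp0.
Qed.

Lemma proj_neq i j x : x \in A i -> j != i -> proj j x = 0.
Proof.
move=> xA ji; have := @proj_sum [:: i] (fun j => if j == i then x else 0) j isT.
rewrite big_seq1 eqxx inE (negPf ji); apply=> l.
by case: eqP => [->//|_]; exact: comp0.
Qed.

Lemma proj_hom i j x : x \in A i -> proj j x = if j == i then x else 0.
Proof.
by move=> xA; case: eqP => [->|/eqP]; [exact: proj_id | exact: proj_neq].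
Qed.

(** The freedom to enlarge the support lets two elements share one. *)
Lemma proj_support x : exists s : seq I, uniq s /\
  forall t, uniq t -> {subset s <= t} -> x = \sum_(i <- t) proj i x.
Proof.
have [[s f] /= [us fA xE]] := ex_decomposition x.
exists s; split=> // t ut st; rewrite {1}xE -(sum_widen f us ut st).
by apply: eq_bigr => i _; rewrite xE proj_sum.
Qed.

Lemma proj_zmod_morphism i : zmod_morphism (proj i).
Proof.
move=> x y; have [s [us xE]] := proj_support x.
have [t [ut yE]] := proj_support y.
pose w := undup (i :: s ++ t).
have uw : uniq w by rewrite undup_uniq.
have iw : i \in w by rewrite mem_undup mem_head.
have E : x - y = \sum_(j <- w) (proj j x - proj j y).
  by rewrite sumrB -xE -?yE // => j; rewrite mem_undup inE mem_cat => ->;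
    rewrite ?orbT.
rewrite {1}E proj_sum ?iw // => j.
by apply: compB; exact: proj_in.
Qed.

HB.instance Definition _ i :=
  GRing.isZmodMorphism.Build V V (proj i) (proj_zmod_morphism i).

Lemma sum_proj x : exists2 s, uniq s & x = \sum_(i <- s) proj i x.
Proof. by have [s [us xE]] := proj_support x; exists s => //; apply: xE. Qed.

Lemma proj_eq0 x : (forall i, proj i x = 0) -> x = 0.
Proof. by move=> p0; have [s _ ->] := sum_proj x; rewrite big1. Qed.

End Components.

(** An additive map that carries the degree [i] part into the degree [sigma i]
    part commutes with taking components; multiplication by homogeneous
    elements is used through this lemma only. *)
Lemma proj_morph (I J : choiceType) (V W : zmodType) (A : I -> {pred V})
    (B : J -> {pred W}) (dsA : internal_direct_sum A)
    (dsB : internal_direct_sum B) (f : V -> W) (sigma : I -> J) :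
  zmod_morphism f -> injective sigma ->
  (forall i x, x \in A i -> f x \in B (sigma i)) ->
  (forall i x, proj dsB (sigma i) (f x) = f (proj dsA i x)) /\
  (forall j x, (forall i, j != sigma i) -> proj dsB j (f x) = 0).
Proof.
move=> fB sI fAB; pose F : {additive V -> W} :=
  HB.pack f (GRing.isZmodMorphism.Build V W f fB).
have pE j i x : proj dsB j (f (proj dsA i x)) =
    if j == sigma i then f (proj dsA i x) else 0.
  exact/proj_hom/fAB/proj_in.
have f_sum t x :
  f (\sum_(l <- t) proj dsA l x) = \sum_(l <- t) f (proj dsA l x).
  exact: (raddf_sum F).
split=> [i x|j x ji]; have [s [us xE]] := proj_support dsA x; last first.
  rewrite [x](xE s) // f_sum raddf_sum big1 // => i _.
  by rewrite /= pE (negPf (ji i)).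
have iw : i \in undup (i :: s) by rewrite mem_undup mem_head.
rewrite {1}[x](xE (undup (i :: s))) ?undup_uniq //; last first.
  by move=> l ls; rewrite mem_undup inE ls orbT.
rewrite f_sum raddf_sum (bigD1_seq i) ?undup_uniq //= pE eqxx big1 ?addr0 //.
by move=> l li; rewrite pE (inj_eq sI) eq_sym (negPf li).
Qed.

(** * Graded rings and graded modules *)

Section GradedRing.
Variables (R : comNzRingType) (G : nat -> {pred R}).
Hypothesis hG : standard_graded G.

Definition graded_direct : internal_direct_sum G :=
  let: And5 _ ds _ _ _ := hG in ds.

Local Notation pr := (proj graded_direct).

Lemma graded_mul i j x y : x \in G i -> y \in G j -> x * y \in G (i + j)%N.
Proof. by have [_ _ h _ _] := hG; exact: h. Qed.

Lemma graded1 : 1 \in G 0%N.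
Proof. by have [_ _ _ [] ] := hG. Qed.

Lemma graded_exp i x n : x \in G i -> x ^+ n \in G (i * n)%N.
Proof.
move=> xG; elim: n => [|n IHn]; first by rewrite muln0 expr0 graded1.
by rewrite exprS mulnS graded_mul.
Qed.

Lemma proj_mul a y n r : y \in G a ->
  pr n (r * y) = if (a <= n)%N then pr (n - a)%N r * y else 0.
Proof.
move=> yG; have [p1 p0] := @proj_morph _ _ _ _ _ _ graded_direct
  graded_direct (fun r => r * y) (fun i => i + a)%N (fun r s => mulrBl y r s)
  (fun i j => @ssrnat.addIn a i j) (fun i x xG => graded_mul xG yG).
case: leqP => [an|na]; first by rewrite -{1}(subnK an) p1.
by apply: p0 => i; rewrite neq_ltn (leq_trans na) ?leq_addl.
Qed.

Variable M : graded_module G.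
Local Notation prM := (proj (gm_direct M)).

Lemma proj_scale_hom (a : int) (u : M) n r : u \in gm_comp M a ->
  prM n (r *: u) = (if n - a is Posz m then pr m r else 0) *: u.
Proof.
move=> ua; have [p1 p0] := @proj_morph _ _ _ _ _ _ graded_direct
  (gm_direct M) (fun r => r *: u) (fun i => i%:Z + a)
  (fun r s => scalerBl r s u) (fun i j e => let: Posz_eq := addIr a e in
    congr1 absz Posz_eq) (fun i x xG => gm_scale xG ua).
case E: (n - a) => [m|m]; first by rewrite -p1 -E subrK.
by rewrite scale0r p0 // => i; apply/eqP => h; rewrite h addrK in E.
Qed.

Lemma proj_hom_scale i r (n : int) (v : M) : r \in G i ->
  prM n (r *: v) = r *: prM (n - i%:Z) v.
Proof.
move=> rG; have [p1 _] := @proj_morph _ _ _ _ _ _ (gm_direct M)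
  (gm_direct M) ( *:%R r) (fun n : int => i%:Z + n) (scalerBr r)
  (@addrI _ i%:Z) (fun j x xG => gm_scale rG xG).
by rewrite -p1 addrC subrK.
Qed.

End GradedRing.

(** * Zero-dimensional rings *)

Section KrullZero.
Variable R : comNzRingType.

(** Unlike [prime_ideal], this admits the unit ideal. *)
Definition is_ideal (A : set R) : Prop :=
  A 0 /\ forall a u v, A u -> A v -> A (a * u + v).

(** An ideal maximal among those that contain [I] and avoid the multiplicative
    set [S] is prime: if [u] and [v] lie outside it, enlarging it by either
    reaches [S], and the product of the elements reached lies in [S] and, if
    [u * v] is in the ideal, in the ideal as well. *)
Lemma prime_avoidance (I S : set R) : is_ideal I -> S 1 ->
  (forall s t, S s -> S t -> S (s * t)) -> (forall s, S s -> ~ I s) ->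
  exists P : {pred R}, [/\ prime_ideal P, forall x, I x -> x \in P
    & forall s, S s -> s \notin P].
Proof.
move=> idI S1 SM dI.
pose C (A : set R) :=
  [/\ is_ideal A, I `<=` A & forall s, S s -> ~ A s].
have [|F [B FB] FC Ftot|A [[[A0 AZ] IA dA] maxA]] :=
    @exists_maximal_set _ C I; first by split.
  have [[B0 _] IB _] := FC _ FB.
  split; [split; first by exists B | by move=> y /IB; exists B |].
    move=> a u v [D FD Du] [E FE Ev].
    have [[_ hD] _ _] := FC _ FD; have [[_ hE] _ _] := FC _ FE.
    have [DE|ED] := Ftot D E FD FE.
      by exists E => //; apply: hE => //; exact: DE.
    by exists D => //; apply: hD => //; exact: ED.
  by move=> s Ss [D FD Ds]; have [_ _ /(_ s Ss)] := FC _ FD.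
have AM a u : A u -> A (a * u) by move=> Au; rewrite -[_ * _]addr0; exact: AZ.
have AD u v : A u -> A v -> A (u + v).
  by move=> Au Av; rewrite -[u]mul1r; exact: AZ.
(* An ideal that contains [A] and some [u] outside [A] meets [S]. *)
have meet u : ~ A u -> exists a r, A a /\ S (a + r * u).
  move=> Au; apply: contrapT => nS.
  apply: (maxA [set x | exists a r, A a /\ x = a + r * u]).
    rewrite properEneq; split; last first.
      by move=> x Ax; exists x, 0; rewrite mul0r addr0.
    apply/eqP => AE; apply: Au; rewrite AE; exists 0, 1.
    by rewrite mul1r add0r.
  split; last 1 first.
  - by move=> s Ss [a [r [Aa sE]]]; apply: nS; exists a, r; rewrite -sE.
  - split; first by exists 0, 0; rewrite mul0r addr0.
    move=> c _ _ [a [r [Aa ->]]] [b [t [Ab ->]]].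
    exists (c * a + b), (c * r + t); split; first exact: AZ.
    by rewrite mulrDr mulrDl !mulrA addrACA.
  - by move=> x /IA Ax; exists x, 0; rewrite mul0r addr0.
exists (set_pred A); split=> [|x /IA|s /dA]; last 2 first.
- by move/set_predP.
- by apply: contra_notN => /set_predP.
split.
  split; [exact/set_predP | exact/set_predP/dA |].
  by move=> a u v /set_predP Au /set_predP Av; apply/set_predP/AZ.
move=> u v /set_predP Auv; apply/orP.
have [Au|/meet [a [r [Aa Sa]]]] := pselect (A u).
  by left; apply/set_predP.
have [Av|/meet [b [t [Ab Sb]]]] := pselect (A v).
  by right; apply/set_predP.
exfalso; apply: (dA _ (SM _ _ Sa Sb)).
rewrite mulrDl; apply: (AD); first by rewrite mulrC; exact: AM.
rewrite mulrDr; apply: (AD); first exact: AM.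
by rewrite mulrACA; exact: AM.
Qed.

(** If no power of [x] were divisible by the next one, the monoid of all
    [x ^+ n * (1 - r * x)] would avoid 0, hence be avoided by a prime [P]; then
    [P + (x)] would be proper, and a prime above it would extend [P] to a chain
    of length one. *)
Lemma krull_dim0_power (x : R) : krull_dim R 0 ->
  exists n r, x ^+ n = r * x ^+ n.+1.
Proof.
move=> [_ dim0]; apply: contrapT => nx.
pose S := [set s | exists n r, s = x ^+ n * (1 - r * x)].
have [||||P [[[P0 P1 PZ] Pprime] _ PS]] := @prime_avoidance [set 0] S.
- by split=> // a u v -> ->; rewrite mulr0 addr0.
- by exists 0%N, 0; rewrite mul0r subr0 mulr1.
- move=> _ _ [n [r ->]] [m [t ->]]; exists (n + m)%N, (r + t - r * t * x).
  by rewrite exprD; ring.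
- move=> _ [n [r ->]] /eqP; rewrite mulrBr mulr1 subr_eq0 => /eqP h.
  by apply: nx; exists n, r; rewrite exprSr mulrCA.
have PM a u : u \in P -> a * u \in P.
  by move=> uP; rewrite -[_ * _]addr0 PZ.
have [||||Q [[idQ Qprime] PQ _]] :=
    @prime_avoidance [set y | exists p r, p \in P /\ y = p + r * x] [set 1].
- split; first by exists 0, 0; rewrite mul0r addr0.
  move=> c _ _ [a [r [Pa ->]]] [b [t [Pb ->]]].
  exists (c * a + b), (c * r + t); split; first exact: PZ.
  by rewrite mulrDr mulrDl !mulrA addrACA.
- by [].
- by move=> _ _ -> ->; rewrite mulr1.
- move=> _ -> [p [r [pP E]]]; have: 1 - r * x \notin P.
    by apply: PS; exists 0%N, r; rewrite expr0 mul1r.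
  by rewrite E addrK pP.
(* [P] and [Q] form a chain of length one. *)
suff : (1 <= 0)%N by [].
apply: dim0; exists (fun i => if i == 0%N then P else Q); split.
  by case=> [|[|//]] _ /=; split.
case=> // _ /=; split.
  by move=> p pP; apply: PQ; exists p, 0; rewrite mul0r addr0.
move=> QP; have: x \notin P.
  by apply: PS; exists 1%N, 0; rewrite mul0r subr0 mulr1.
by rewrite QP //; apply: PQ; exists 0, 1; rewrite mul1r add0r.
Qed.

Lemma nilpotent_sum (I : Type) (s : seq I) (f : I -> R) :
  (forall i, exists n, f i ^+ n = 0) -> exists n, (\sum_(i <- s) f i) ^+ n = 0.
Proof.
move=> fn; elim: s => [|i s [m sm]]; first by exists 1%N; rewrite big_nil.
have [n fin] := fn i; exists (n + m)%N; rewrite big_cons exprDn big1 // => j _.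
have [mj|jm] := leqP m j.
  by rewrite -(subnK mj) [X in _ * X]exprD sm !mulr0 mul0rn.
have nj : (n <= n + m - j)%N by rewrite -addnBA ?leq_addr // ltnW.
by rewrite -(subnK nj) [X in X * _]exprD fin mulr0 mul0r mul0rn.
Qed.

Variable G : nat -> {pred R}.
Hypothesis hG : standard_graded G.
Hypothesis dim0 : krull_dim R 0.

(** In [x ^+ n = r * x ^+ n.+1] the right-hand side has no component in the
    degree [i * n] of the left-hand side. *)
Lemma homogeneous_nilpotent i x : x \in G i -> (0 < i)%N ->
  exists n, x ^+ n = 0.
Proof.
move=> xG i0; have [n [r E]] := krull_dim0_power x dim0; exists n.
have xn := graded_exp hG n xG.
rewrite -(proj_id (graded_direct hG) xn) E.
rewrite (proj_mul hG (a := (i * n.+1)%N)) ?(graded_exp hG) //.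
by rewrite leq_pmul2l // ltnn.
Qed.

Lemma irrelevant_nilpotent x : irrelevant_ideal G x -> exists n, x ^+ n = 0.
Proof.
move=> [s [f [s0 fG ->]]].
rewrite (_ : \sum_(i <- s) f i = \sum_(i <- s) if i == 0%N then 0 else f i).
  apply: nilpotent_sum => i; case: eqP => [_|/eqP i0].
    by exists 1%N.
  by apply: (@homogeneous_nilpotent i); rewrite ?lt0n.
rewrite !big_seq; apply: eq_bigr => i; case: eqP => // -> h.
by rewrite h in s0.
Qed.

(** A nonempty regular sequence would start with an element that is both
    nilpotent and injective on [V]. *)
Lemma depth_krull0 (V : lmodType R) (v : V) : v != 0 -> depth G V 0.
Proof.
have nil0 u : ideal_smul [::] u -> u = 0 :> V.
  by move=> [w ->]; rewrite big_ord0.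
move=> v0; split.
  exists [::] => //; split=> //; split=> //; exists v => /nil0 /eqP.
  by rewrite (negPf v0).
move=> [|s ss] // [sm [reg _]]; exfalso.
have [n sn] := irrelevant_nilpotent (sm s (mem_head _ _)).
have inj (u : V) : s *: u = 0 -> u = 0.
  move=> su; apply: nil0; apply: (reg 0%N) => //=.
  by rewrite su; exists (fun=> 0); rewrite big_ord0.
case/eqP: v0; elim: n sn => [|n IHn] sn.
  by rewrite -[v]scale1r -[1](expr0 s) sn scale0r.
have: s ^+ n.+1 *: v = 0 by rewrite sn scale0r.
elim: n.+1 => [|m IHm]; first by rewrite expr0 scale1r.
by rewrite exprS -scalerA => /inj.
Qed.

Lemma mcm_krull0 (M : graded_module G) : fin_gen M -> (exists v : M, v != 0) ->
  maximal_cohen_macaulay M.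
Proof.
move=> fgM [v v0]; split=> //; exists 0%N => //; exact: depth_krull0 v0.
Qed.

End KrullZero.

(** * Cyclic quotients *)

Section QuotientModule.
Variable R : comNzRingType.
Implicit Types (h r : R).

Definition principal_ideal h : {pred R} :=
  set_pred [set r | exists q, r = q * h].

Lemma principal_idealP h r :
  reflect (exists q, r = q * h) (r \in principal_ideal h).
Proof. exact: set_predP. Qed.

Lemma principal_ideal_zmod h : GRing.zmod_closed (principal_ideal h).
Proof.
split=> [|_ _ /principal_idealP[q ->] /principal_idealP[t ->]].
  by apply/principal_idealP; exists 0; rewrite mul0r.
by apply/principal_idealP; exists (q - t); rewrite mulrBl.
Qed.

HB.instance Definition _ h :=
  GRing.isZmodClosed.Build R (principal_ideal h) (principal_ideal_zmod h).

Lemma principal_ideal_mull h a r :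
  r \in principal_ideal h -> a * r \in principal_ideal h.
Proof.
move=> /principal_idealP[q ->]; apply/principal_idealP.
by exists (a * q); rewrite mulrA.
Qed.

Definition quotient_module h := Quotient.quot (principal_ideal h).

HB.instance Definition _ h := GRing.Zmodule.on (quotient_module h).

Variable h : R.
Local Notation Q := (quotient_module h).

Definition quotient_class r : Q := \pi_(Quotient.quot (principal_ideal h))%qT r.
Local Notation cl := quotient_class.

Lemma quotient_class_zmod_morphism : zmod_morphism cl.
Proof. exact: raddfB. Qed.

HB.instance Definition _ :=
  GRing.isZmodMorphism.Build R Q cl quotient_class_zmod_morphism.

Lemma quotient_class_eq0 r : (cl r == 0) = (r \in principal_ideal h).
Proof.
rewrite -(raddf0 cl) -[r in RHS]subr0 /quotient_class.
by rewrite Quotient.idealrBE.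
Qed.

Lemma quotient_class_eq r s : (cl r == cl s) = (r - s \in principal_ideal h).
Proof. by rewrite -subr_eq0 -raddfB quotient_class_eq0. Qed.

Lemma quotient_classK (x : Q) : cl (repr x) = x.
Proof. exact: reprK. Qed.

Definition quotient_scale a (x : Q) : Q := cl (a * repr x).

(** The representative chosen in [quotient_scale] is immaterial because the
    ideal absorbs multiplication. *)
Lemma quotient_scaleE a r : quotient_scale a (cl r) = cl (a * r).
Proof.
apply/eqP; rewrite quotient_class_eq -mulrBr principal_ideal_mull //.
by rewrite -quotient_class_eq quotient_classK.
Qed.

Fact quotient_scaleA a b (x : Q) :
  quotient_scale a (quotient_scale b x) = quotient_scale (a * b) x.
Proof. by rewrite -[x]quotient_classK !quotient_scaleE mulrA. Qed.

Fact quotient_scale1 : left_id 1 quotient_scale.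
Proof. by move=> x; rewrite -[x]quotient_classK quotient_scaleE mul1r. Qed.

Fact quotient_scaleDr : right_distributive quotient_scale +%R.
Proof.
move=> a x y; rewrite -[x]quotient_classK -[y]quotient_classK -raddfD.
by rewrite !quotient_scaleE -raddfD mulrDr.
Qed.

Fact quotient_scaleDl (x : Q) : {morph quotient_scale^~ x : a b / a + b}.
Proof.
by move=> a b; rewrite -[x]quotient_classK !quotient_scaleE mulrDl raddfD.
Qed.

HB.instance Definition _ := GRing.Zmodule_isLmodule.Build R Q
  quotient_scaleA quotient_scale1 quotient_scaleDr quotient_scaleDl.

Lemma quotient_classZ a r : a *: (cl r : Q) = cl (a * r).
Proof. exact: quotient_scaleE. Qed.

Lemma quotient_class_surj (x : Q) : exists r, x = cl r.
Proof. by exists (repr x); rewrite quotient_classK. Qed.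

End QuotientModule.

Section GradedQuotient.
Variables (R : comNzRingType) (G : nat -> {pred R}).
Hypothesis hG : standard_graded G.
Variables (d : nat) (h : R).
Hypothesis hd : h \in G d.

Local Notation Q := (quotient_module h).
Local Notation cl := (quotient_class h).
Local Notation pr := (proj (graded_direct hG)).

Definition quotient_comp (j : int) : {pred Q} :=
  set_pred [set x | if j is Posz n then exists2 r, r \in G n & x = cl r
                    else x = 0].

Lemma quotient_comp_posP n x :
  reflect (exists2 r, r \in G n & x = cl r) (x \in quotient_comp (Posz n)).
Proof. exact: set_predP. Qed.

Lemma quotient_comp_neg n x : x \in quotient_comp (Negz n) -> x = 0.
Proof. by move/set_predP. Qed.

(** This is where the homogeneity of [h] matters: it makes [(h)] a graded
    ideal. *)
Lemma proj_principal_ideal n r :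
  r \in principal_ideal h -> pr n r \in principal_ideal h.
Proof.
move=> /principal_idealP[q ->]; rewrite (proj_mul hG _ _ hd).
case: ifP => _; apply/principal_idealP; last by exists 0; rewrite mul0r.
by exists (pr (n - d)%N q).
Qed.

Lemma quotient_direct : internal_direct_sum quotient_comp.
Proof.
have comp0' j : 0 \in quotient_comp j.
  case: j => j; last exact/set_predP.
  apply/quotient_comp_posP; exists 0; last by rewrite raddf0.
  exact: (comp0 (graded_direct hG)).
split=> [j|x|s f us fQ f0].
- split=> // x y; case: j => [n|n].
    move=> /quotient_comp_posP[r rG ->] /quotient_comp_posP[t tG ->].
    apply/quotient_comp_posP; exists (r - t); last by rewrite raddfB.
    exact: (compB (graded_direct hG)).
  by move=> /quotient_comp_neg -> /quotient_comp_neg ->; rewrite subrr.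
- have [r ->] := quotient_class_surj x.
  have [s us {1}->] := sum_proj (graded_direct hG) r.
  exists (map Posz s), (fun j => if j is Posz n then cl (pr n r) else 0).
  split; first by rewrite map_inj_uniq // => ? ? [].
    case=> n; last exact: comp0'.
    by apply/quotient_comp_posP; exists (pr n r) => //; exact: proj_in.
  by rewrite big_map raddf_sum.
(* Lift the summands to homogeneous elements of [R]; their sum is in the ideal,
   hence so is each component of that sum. *)
have lift j : exists y, f j = cl y /\
    if j is Posz n then y \in G n else y = 0.
  case: j => n.
    by have /quotient_comp_posP[r rG ->] := fQ (Posz n); exists r.
  by have /quotient_comp_neg -> := fQ (Negz n); exists 0; rewrite raddf0.
have [g gP] := choice lift.
have gI : \sum_(j <- s) g j \in principal_ideal h.
  rewrite -quotient_class_eq0 raddf_sum -[X in _ == X]f0; apply/eqP.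
  by apply: eq_bigr => j _; have [-> _] := gP j.
case=> n ns; last exact: quotient_comp_neg (fQ (Negz n)).
have [-> gn] := gP (Posz n); apply/eqP; rewrite quotient_class_eq0.
have := proj_principal_ideal n gI.
rewrite raddf_sum (bigD1_seq (Posz n)) //= (proj_id _ gn).
rewrite big1 ?addr0 // => j jn.
have [_] := gP j; case: j jn => [m|m] jn; last by move=> ->; rewrite raddf0.
by move=> gm; apply: (proj_neq _ gm); apply: contra_neq jn => ->.
Qed.

Lemma quotient_comp_scale (i : nat) (j : int) (a : R) (x : Q) :
  a \in G i -> x \in quotient_comp j -> a *: x \in quotient_comp (i%:Z + j).
Proof.
move=> aG; case: j => [n /quotient_comp_posP[r rG ->]|n /quotient_comp_neg ->].
  rewrite quotient_classZ; apply/quotient_comp_posP; exists (a * r) => //.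
  exact: graded_mul.
by rewrite scaler0 (comp0 quotient_direct).
Qed.

Definition graded_quotient : graded_module G :=
  GradedModule quotient_direct quotient_comp_scale.

Lemma graded_quotient_cyclic (v : graded_quotient) :
  exists r, v = r *: (cl 1 : Q).
Proof.
have [r ->] := quotient_class_surj v; exists r.
by rewrite quotient_classZ mulr1.
Qed.

Lemma graded_quotient_ann r :
  (forall v : graded_quotient, r *: v = 0) <-> r \in principal_ideal h.
Proof.
split=> [/(_ (cl 1))/eqP|rh v].
  by rewrite quotient_classZ mulr1 quotient_class_eq0.
have [t ->] := quotient_class_surj v; apply/eqP.
by rewrite quotient_classZ quotient_class_eq0 mulrC principal_ideal_mull.
Qed.

(** In positive degree the generator [h] of the ideal cannot divide 1. *)
Lemma quotient_class1_neq0 : (0 < d)%N -> cl 1 != 0.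
Proof.
move=> d0; rewrite quotient_class_eq0; apply/principal_idealP => -[q E].
have := proj_mul hG 0 q hd; rewrite -E leqNgt d0 /=.
rewrite (proj_id _ (graded1 hG)) => /eqP.
by rewrite oner_eq0.
Qed.

End GradedQuotient.

Section CyclicModules.
Variables (R : comNzRingType) (G : nat -> {pred R}).
Hypothesis hG : standard_graded G.
Variables (M : graded_module G) (a : int) (u : M).
Hypothesis ua : u \in gm_comp M a.
Hypothesis cyc : forall v : M, exists r, v = r *: u.

Local Notation pr := (proj (graded_direct hG)).
Local Notation prM := (proj (gm_direct M)).

(** If [M] splits, the generator [u] is a sum of its two components of degree
    [a], which are scalar multiples of [u] because [R_0] is a field; a nonzero
    multiple generates [M]. *)
Lemma cyclic_indecomposable : u != 0 -> gm_indecomposable M.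
Proof.
move=> u0; split; first by exists u.
have fill (N : {pred M}) (N' : {pred M}) c : graded_submodule N ->
    (forall x, x \in N -> x \in N' -> x = 0) -> c \in G 0%N -> c != 0 ->
    c *: u \in N -> forall x, x \in N' -> x = 0.
  move=> [[N0 NZ] _] NN' cG c0 cuN x xN'; apply: NN' => //.
  have [_ _ _ [_ /(_ c cG c0) [e _ ce]] _] := hG.
  have [r ->] := cyc x; rewrite -[r]mulr1 -ce [c * e]mulrC mulrA -scalerA.
  by rewrite -[_ *: _]addr0 NZ.
move=> N1 N2 N1s N2s N12 N120.
have proj_a_in (N : {pred M}) v :
    graded_submodule N -> v \in N -> prM a v \in N.
  move=> [[N0 NZ] Ngr] vN; have [s us vE] := sum_proj (gm_direct M) v.
  have [as_|as_] := boolP (a \in s).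
    apply: (Ngr s (fun i => prM i v)) => //; last by rewrite -vE.
    by move=> i; exact: proj_in.
  rewrite vE (proj_sum (gm_direct M) _ us) ?(negPf as_) // => i; exact: proj_in.
have [v1 [v2 [v1N v2N uE]]] := N12 u.
have scal v : exists2 c, c \in G 0%N & prM a v = c *: u.
  have [r ->] := cyc v; exists (pr 0%N r); first exact: proj_in.
  by rewrite (proj_scale_hom hG _ _ ua) subrr.
have [c1 c1G v1E] := scal v1; have [c2 c2G v2E] := scal v2.
have [c10|c10] := eqVneq c1 0; [left|right].
  have c20 : c2 != 0.
    apply: contraNneq u0 => c20; rewrite -(proj_id (gm_direct M) ua) uE.
    by rewrite raddfD /= v1E v2E c10 c20 !scale0r addr0.
  apply: (fill N2 N1 c2) => //; last by rewrite -v2E proj_a_in.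
  by move=> x x2 x1; exact: N120.
by apply: (fill N1 N2 c1) => //; rewrite -v1E proj_a_in.
Qed.

Lemma cyclic_fin_gen : fin_gen M.
Proof.
exists [:: u] => v; have [r ->] := cyc v; exists (fun=> r).
by rewrite big_ord_recl big_ord0 addr0.
Qed.

(** The isomorphism sends [r *: u] to the class of [r]; the annihilator
    condition makes it well defined and injective. *)
Lemma cyclic_shift_iso d h (hd : h \in G d) :
  (forall r, r *: u = 0 <-> r \in principal_ideal h) ->
  gm_shift_iso M (graded_quotient hG hd).
Proof.
move=> annE; have [rho rhoE] := choice cyc.
pose f v : graded_quotient hG hd := quotient_class h (rho v).
have fE r : f (r *: u) = quotient_class h r.
  apply/eqP; rewrite quotient_class_eq; apply/annE.
  by rewrite scalerBl -rhoE subrr.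
have f_lin : linear f.
  move=> c v w; have [r ->] := cyc v; have [t ->] := cyc w.
  rewrite scalerA -scalerDl !fE.
  by rewrite quotient_classZ -raddfD.
pose F : {linear M -> graded_quotient hG hd} :=
  HB.pack f (GRing.isLinear.Build R M (graded_quotient hG hd) *:%R f f_lin).
have f_inj v : f v = 0 -> v = 0.
  have [r ->] := cyc v; rewrite fE => /eqP; rewrite quotient_class_eq0.
  by move/annE.
exists (- a), F; split.
  exists (fun x : quotient_module h => repr x *: u) => [v|x].
    apply/subr0_eq/f_inj; rewrite -[f _]/(F _) raddfB /= fE quotient_classK.
    by rewrite subrr.
  by rewrite /= fE quotient_classK.
move=> i v; apply/idP/idP => [vi|].
  have [r vE] := cyc v; rewrite -(proj_id (gm_direct M) vi) vE.
  rewrite (proj_scale_hom hG _ _ ua) /= fE.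
  case: (i - a) => n; last by rewrite raddf0 (comp0 (quotient_direct hG hd)).
  by apply/quotient_comp_posP; exists (pr n r) => //; exact: proj_in.
case E: (i - a) => [n|n].
  move=> /quotient_comp_posP[r rG fv].
  have -> : v = r *: u.
    apply/subr0_eq/f_inj; rewrite -[f _]/(F _) raddfB /= fE (fv : f v = _).
    by rewrite subrr.
  by rewrite -[i](subrK a) E gm_scale.
move=> vn; rewrite (f_inj v (@quotient_comp_neg _ G h n _ vn)).
exact: (comp0 (gm_direct M)).
Qed.

End CyclicModules.

Lemma graded_quotient_mcm (R : comNzRingType) (G : nat -> {pred R})
    (hG : standard_graded G) d h (hd : h \in G d) : krull_dim R 0 ->
  (0 < d)%N -> gm_indecomposable (graded_quotient hG hd) /\
               maximal_cohen_macaulay (graded_quotient hG hd).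
Proof.
move=> dim0 d0; have u0 := quotient_class1_neq0 hG hd d0.
have cyc := @graded_quotient_cyclic _ _ hG _ _ hd; split.
  apply: (cyclic_indecomposable hG (a := 0) _ cyc u0).
  by apply/quotient_comp_posP; exists 1 => //; exact: graded1 hG.
apply: (mcm_krull0 hG dim0 (cyclic_fin_gen cyc)).
by exists (quotient_class h 1).
Qed.

Lemma shift_iso_ann (R : comNzRingType) (G : nat -> {pred R})
    (M N : graded_module G) r : gm_shift_iso M N ->
  (forall v : M, r *: v = 0) <-> (forall w : N, r *: w = 0).
Proof.
move=> [n [f [[g gK fK] _]]]; split=> h v.
  by rewrite -[v]fK -linearZ /= h linear0.
by apply: (can_inj gK); rewrite linearZ /= h linear0.
Qed.

(** * Algebras generated by one element of degree one *)

Section OneGenerator.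
Variables (k : fieldType) (R : comAlgType k) (G : nat -> {pred R}).
Hypothesis hG : standard_graded G.
Hypothesis R0_k : forall x : R, x \in G 0%N <-> exists c : k, x = c%:A.

Local Notation pr := (proj (graded_direct hG)).

Lemma component_scale (c : k) i (x : R) : x \in G i -> c *: x \in G i.
Proof.
move=> xG; rewrite -mulr_algl -[i]add0n (graded_mul hG) //.
by apply/R0_k; exists c.
Qed.

Lemma horner_algE (x : R) (p : {poly k}) :
  horner_alg x p = \sum_(i < size p) p`_i *: x ^+ i.
Proof.
rewrite -[in LHS](coefK p) poly_def linear_sum; apply: eq_bigr => i _.
by rewrite linearZ /= mulr_algl rmorphXn /= horner_algX.
Qed.

Lemma proj_horner_alg x (p : {poly k}) n : x \in G 1%N ->
  pr n (horner_alg x p) = p`_n *: x ^+ n.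
Proof.
move=> xG; rewrite horner_algE -(big_mkord xpredT (fun i => p`_i *: x ^+ i)).
rewrite proj_sum ?iota_uniq //.
  rewrite mem_index_iota /=; case: ltnP => // /(nth_default 0) ->.
  by rewrite scale0r.
by move=> j; apply: component_scale; rewrite -[X in G X]mul1n graded_exp.
Qed.

Definition generates (x : R) :=
  forall r, exists p : {poly k}, r = horner_alg x p.

(** The polynomials in [x] form a subring that contains [R_0] and [R_1]. *)
Lemma degree1_generates x :
  (forall y, y \in G 1%N -> exists c : k, y = c *: x) -> generates x.
Proof.
move=> x1; have [_ _ _ _ genG] := hG.
pose S : {pred R} := set_pred [set r | exists p : {poly k}, r = horner_alg x p].
suff SR r : r \in S by move=> r; exact/(set_predP _ _ (SR r)).
apply: genG r; last 2 first.
- move=> _ /R0_k[c ->]; apply/set_predP; exists c%:P.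
  by rewrite horner_algC.
- move=> _ /x1[c ->]; apply/set_predP; exists (c *: 'X).
  by rewrite linearZ /= mulr_algl horner_algX.
split; first by apply/set_predP; exists 1; rewrite rmorph1.
  move=> _ _ /set_predP[p ->] /set_predP[q ->]; apply/set_predP.
  by exists (p - q); rewrite rmorphB.
move=> _ _ /set_predP[p ->] /set_predP[q ->]; apply/set_predP.
by exists (p * q); rewrite rmorphM.
Qed.

(** The module [R / (y + c x)] determines its annihilator [(y + c x)], hence the
    line that this ideal cuts out in degree 1, hence [c].  So mapping [c] to the
    index of that module in a countable list is injective. *)
Lemma countable_field x y : krull_dim R 0 -> graded_countable_CM_type G ->
  x \in G 1%N -> y \in G 1%N -> x != 0 -> (forall c : k, y <> c *: x) ->
  countable [set: k].
Proof.
move=> dim0 [I [F [_ Fall]]] xG yG x0 xy.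
have lG c : y + c *: x \in G 1%N.
  by apply: (compD (graded_direct hG)) => //; exact: component_scale.
have listed c : exists j, gm_shift_iso (graded_quotient hG (lG c)) (F j).
  by apply: Fall; have [] := graded_quotient_mcm hG (lG c) dim0 isT.
have [i iP] := choice listed.
apply/countable_injP; exists (pickle \o i).
move=> c c' _ _ /= /(pcan_inj pickleK) icc'.
have: y + c' *: x \in principal_ideal (y + c *: x).
  apply/(graded_quotient_ann hG (lG c))/(shift_iso_ann _ (iP c)); rewrite icc'.
  apply/(shift_iso_ann _ (iP c'))/graded_quotient_ann.
  by apply/principal_idealP; exists 1; rewrite mul1r.
move=> /principal_idealP[q E].
have := proj_mul hG 1 q (lG c); rewrite -E (proj_id _ (lG c')) /= subnn.
have /R0_k[a ->] := proj_in (graded_direct hG) 0%N q.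
rewrite mulr_algl => {}E.
have Exy : (1 - a) *: y = (a * c - c') *: x.
  apply/eqP; rewrite scalerBl scale1r subr_eq scalerBl addrAC -subr_eq opprK.
  by rewrite E scalerDr scalerA addrC.
have a1 : a = 1.
  apply/eqP; rewrite eq_sym -subr_eq0.
  apply: contra_notT (xy ((1 - a)^-1 * (a * c - c'))) => a1.
  by rewrite -scalerA -Exy scalerA mulVf // scale1r.
move/eqP: Exy; rewrite a1 subrr scale0r mul1r eq_sym scaler_eq0 (negPf x0) orbF.
by rewrite subr_eq0 => /eqP.
Qed.

Lemma countable_type_generator : ~ countable [set: k] -> krull_dim R 0 ->
  graded_countable_CM_type G -> exists2 x, x \in G 1%N & generates x.
Proof.
move=> kunc dim0 ctype.
suff [x xG x1] : exists2 x, x \in G 1%N &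
    forall y, y \in G 1%N -> exists c : k, y = c *: x.
  by exists x => //; exact: degree1_generates.
apply: contrapT => nx.
have next x : x \in G 1%N -> exists2 y, y \in G 1%N & forall c : k, y <> c *: x.
  move=> xG; apply: contrapT => ny; apply: nx; exists x => // y yG.
  apply: contrapT => nc; apply: ny; exists y => // c E; apply: nc.
  by exists c.
have [x xG x0] := next 0 (comp0 (graded_direct hG) _).
have [y yG xy] := next x xG.
apply: kunc; apply: (countable_field dim0 ctype xG yG _ xy).
by apply/eqP => E; apply: (x0 0); rewrite scale0r.
Qed.

(** The canonical isomorphism from [{mpoly k[1]}] to [{poly k}]. *)
Definition univariate (p : {mpoly k[1]}) : {poly k} :=
  \sum_(m <- msupp p) p@_m *: 'X^(mdeg m).

Lemma mnm1_mdeg (m : 'X_{1..1}) : m = (U_(ord0) *+ mdeg m)%MM.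
Proof.
apply/mnmP => i; rewrite ord1 mulmnE mnm1E eqxx mul1n mdegE.
by rewrite big_ord_recl big_ord0 addn0.
Qed.

Lemma coef_univariate p n : (univariate p)`_n = p@_(U_(ord0) *+ n)%MM.
Proof.
have nE (m : 'X_{1..1}) : (n == mdeg m) = (m == (U_(ord0) *+ n)%MM).
  apply/eqP/eqP => [->|->]; first exact: mnm1_mdeg.
  by rewrite mdegMn mdeg1 mul1n.
rewrite /univariate coef_sum.
under eq_bigr => m _ do rewrite coefZ coefXn nE.
have [sm|sm] := boolP ((U_(ord0) *+ n)%MM \in msupp p); last first.
  rewrite (memN_msupp_eq0 sm) big_seq big1 // => m mp.
  by case: eqP mp => [->|_ _]; rewrite ?(negPf sm) // mulr0.
rewrite (bigD1_seq _ sm) ?msupp_uniq //= eqxx mulr1 big1 ?addr0 // => m.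
by move=> /negPf ->; rewrite mulr0.
Qed.

Lemma lrmorphism_univariate (phi : {lrmorphism {mpoly k[1]} -> R}) p :
  phi p = horner_alg (phi 'X_ord0) (univariate p).
Proof.
rewrite {1}[p]mpolyE !linear_sum; apply: eq_bigr => m _.
rewrite !linearZ /= mulr_algl rmorphXn /= horner_algX -rmorphXn /= mpolyXn.
by rewrite -mnm1_mdeg.
Qed.

Lemma univariate_evaluation (x : R) :
  exists phi : {lrmorphism {mpoly k[1]} -> R}, phi 'X_ord0 = x.
Proof.
pose phi0 := mmap (GRing.in_alg R) (fun _ : 'I_1 => x).
have phi0Z : scalable phi0.
  by move=> c p; rewrite /phi0 mmapZ /= mulr_algl.
pose phi : {lrmorphism {mpoly k[1]} -> R} :=
  HB.pack phi0 (GRing.RMorphism.on phi0)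
    (GRing.isScalable.Build k {mpoly k[1]} R *:%R phi0 phi0Z).
by exists phi; rewrite /= /phi0 mmapX mmap1U.
Qed.

(** With [e] the first exponent such that [x ^+ e = 0], a polynomial vanishes at
    [x] iff all its terms do, by comparison of degrees, iff it is divisible by
    the [e]-th power of the variable. *)
Lemma generator_hypersurface x N : x \in G 1%N -> generates x -> x ^+ N = 0 ->
  hypersurface G.
Proof.
move=> xG xgen xN.
have ex : exists n, x ^+ n == 0 by exists N; apply/eqP.
have [e [xe emin]] :
    exists e, x ^+ e = 0 /\ forall n, x ^+ n = 0 -> (e <= n)%N.
  case: (ex_minnP ex) => e /eqP xe emin; exists e; split=> // i xi.
  by apply: emin; rewrite xi.
have [phi phiX] := univariate_evaluation x.
have phiE p : phi p = horner_alg x (univariate p).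
  by rewrite lrmorphism_univariate phiX.
have phi_proj p n : pr n (phi p) = p@_(U_(ord0) *+ n)%MM *: x ^+ n.
  by rewrite phiE proj_horner_alg // coef_univariate.
exists 1%N, e, ('X_ord0 ^+ e), phi; split.
- by rewrite mpolyXn dhomogX /= mdegMn mdeg1 mul1n.
- move=> r; have [q ->] := xgen r.
  exists (\sum_(i < size q) q`_i *: 'X_ord0 ^+ i).
  rewrite horner_algE linear_sum; apply: eq_bigr => i _.
  by rewrite linearZ rmorphXn /= phiX.
- move=> p; split=> [p0|[q ->]]; last first.
    by rewrite rmorphM rmorphXn /= phiX xe mulr0.
  have pe m : m \in msupp p -> (e <= mdeg m)%N.
    rewrite mcoeff_msupp => pm; apply: emin; apply/eqP.
    have := phi_proj p (mdeg m); rewrite -mnm1_mdeg p0 raddf0 => /esym/eqP.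
    by rewrite scaler_eq0 (negPf pm).
  exists (\sum_(m <- msupp p) p@_m *: 'X_ord0 ^+ (mdeg m - e)).
  rewrite {1}[p]mpolyE mulr_suml !big_seq; apply: eq_bigr => m /pe em.
  by rewrite -scalerAl -exprD subnK // mpolyXn -mnm1_mdeg.
- move=> d p pd; rewrite -[phi p](subrK (pr d (phi p))).
  rewrite [X in X + _](_ : _ = 0) ?add0r ?proj_in //.
  apply: (proj_eq0 (dsA := graded_direct hG)) => n; rewrite raddfB /=.
  rewrite (proj_hom _ _ (proj_in _ _ _)); case: eqP => [->|/eqP nd].
    by rewrite subrr.
  rewrite subr0 phi_proj (dhomog_nemf_coeff pd) ?scale0r //.
  by rewrite /= mdegMn mdeg1 mul1n.
Qed.

(** Leading monomials are multiplicative, so that of [f] divides a power of each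
    of two distinct variables and must be 1, the least monomial. *)
Lemma common_divisor_powers n (i j : 'I_n) (f p q : {mpoly k[n]}) a b :
  i != j -> 'X_i ^+ a = p * f -> 'X_j ^+ b = q * f ->
  exists2 c : k, c != 0 & f = c%:MP.
Proof.
move=> ij pf qf.
have nz l c (r : {mpoly k[n]}) : 'X_l ^+ c = r * f ->
    (mlead r + mlead f = U_(l) *+ c)%MM /\ f != 0.
  move=> rf; have : r * f != 0.
    by rewrite -rf mpolyXn -msize_poly_eq0 msizeX.
  rewrite mulf_eq0 negb_or => /andP[r0 f0]; split=> //.
  by rewrite -mleadM // -rf mpolyXn mleadXm.
have [pl f0] := nz _ _ _ pf; have [ql _] := nz _ _ _ qf.
have : mlead f = 0%MM.
  apply/mnmP => l; rewrite mnm0E; apply/eqP; rewrite -leqn0.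
  have [li|li] := eqVneq l i.
    have /mnmP/(_ l) := ql; rewrite mnmDE mulmnE mnm1E li eq_sym (negPf ij).
    by move=> /eqP; rewrite mul0n addn_eq0 => /andP[_ /eqP ->].
  have /mnmP/(_ l) := pl; rewrite mnmDE mulmnE mnm1E eq_sym (negPf li).
  by move=> /eqP; rewrite mul0n addn_eq0 => /andP[_ /eqP ->].
by move=> lf; apply/msize_poly1P; rewrite -mlead_deg // lf mdeg0.
Qed.

(** In a zero-dimensional hypersurface ring every variable is nilpotent, so [f]
    divides a power of each variable; with two variables [f] would be a unit. *)
Lemma hypersurface_generator : krull_dim R 0 -> hypersurface G ->
  exists2 x, x \in G 1%N & generates x.
Proof.
move=> dim0 [n [d [f [phi [_ phi_surj phi_ker phiG]]]]].
have XG i : phi 'X_i \in G 1%N by apply: phiG; rewrite dhomogX /= mdeg1.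
case: n f phi phi_surj phi_ker {phiG} XG => [|[|n]] f phi phi_surj phi_ker XG.
- (* Without variables [R = k], which is generated by 0. *)
  exists 0; first exact: (comp0 (graded_direct hG)).
  move=> r; have [p <-] := phi_surj r; exists (p@_0%MM)%:P.
  have -> : p = p@_0%MM *: 1.
    apply/mpolyP => m; have -> : m = 0%MM by apply/mnmP => -[].
    by rewrite mcoeffZ mcoeff1 eqxx mulr1.
  by rewrite linearZ rmorph1 /= mcoeffZ mcoeff1 eqxx mulr1 horner_algC.
- exists (phi 'X_ord0) => // r; have [p <-] := phi_surj r.
  by exists (univariate p); exact: lrmorphism_univariate.
exfalso; have pow i : exists a q, 'X_i ^+ a = q * f.
  have [a xa] := homogeneous_nilpotent hG dim0 (XG i) isT.
  have /phi_ker[q E] : phi ('X_i ^+ a) = 0 by rewrite rmorphXn.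
  by exists a, q.
have [a [p pf]] := pow ord0; have [b [q qf]] := pow ord_max.
have [//|c c0 fE] := common_divisor_powers _ pf qf.
have /eqP : phi 1 = 0.
  apply/phi_ker; exists (c^-1)%:MP.
  by rewrite fE -mpolyCM mulVf.
by rewrite rmorph1 oner_eq0.
Qed.

End OneGenerator.

(** * Graded modules over a truncated polynomial ring *)

(** A [k]-subspace maximal among those that avoid [w] is a complement of the
    line through [w]; the functional is the coordinate along that line.  Scalars
    act through [k -> R], since [M] is only given as an [R]-module. *)
Lemma exists_functional (k : fieldType) (R : comAlgType k) (M : lmodType R)
    (w : M) : w != 0 ->
  exists lam : M -> k, [/\ forall u v, lam (u + v) = lam u + lam v,
    forall c v, lam (c%:A *: v) = c * lam v & lam w = 1].
Proof.
move=> w0; pose sub (A : set M) :=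
  A 0 /\ forall (c : k) u v, A u -> A v -> A (c%:A *: u + v).
pose C (A : set M) := sub A /\ ~ A w.
have [|F [B FB] FC Ftot|A [[[A0 AZ] Aw] maxA]] :=
    @exists_maximal_set _ C [set 0].
- split; last by move/eqP; rewrite (negPf w0).
  by split=> // c u v -> ->; rewrite scaler0 addr0.
- split; last by move=> [D FD Dw]; have [_] := FC _ FD.
  split; first by exists B => //; have [[]] := FC _ FB.
  move=> c y z [D FD Dy] [E FE Ez].
  have [[_ hD] _] := FC _ FD; have [[_ hE] _] := FC _ FE.
  have [DE|ED] := Ftot D E FD FE.
    by exists E => //; apply: hE => //; exact: DE.
  by exists D => //; apply: hD => //; exact: ED.
have AZ0 c v : A v -> A (c%:A *: v).
  by move=> Av; rewrite -[_ *: _]addr0; exact: AZ.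
have AN v : A v -> A (- v) by move=> /(AZ0 (-1)); rewrite !scaleN1r.
have AD u v : A u -> A v -> A (u + v).
  by move=> Au Av; rewrite -[u]scale1r -[1](scale1r (1 : R)); exact: AZ.
have algM (c d : k) : (c * d)%:A = c%:A * d%:A :> R.
  by rewrite mulr_algl scalerA.
have algD (c d : k) : (c + d)%:A = c%:A + d%:A :> R by rewrite scalerDl.
have algB (c d : k) : (c - d)%:A = c%:A - d%:A :> R by rewrite scalerBl.
have coord v : exists c : k, A (v - c%:A *: w).
  have [Av|Av] := pselect (A v); first by exists 0; rewrite !scale0r subr0.
  have [a [d [Aa wE]]] : exists a (d : k), A a /\ w = a + d%:A *: v.
    apply: contrapT => nw.
    apply: (maxA [set y | exists a (d : k), A a /\ y = a + d%:A *: v]).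
      rewrite properEneq; split; last first.
        by move=> y Ay; exists y, 0; rewrite !scale0r addr0.
      apply/eqP => E; apply: Av; rewrite E; exists 0, 1.
      by rewrite !scale1r add0r.
    split=> //; split; first by exists 0, 0; rewrite !scale0r addr0.
    move=> c _ _ [a [d [Aa ->]]] [b [d' [Ab ->]]].
    exists (c%:A *: a + b), (c * d + d'); split; first exact: AZ.
    by rewrite algD algM scalerDr scalerA scalerDl addrACA.
  have d0 : d != 0.
    by apply: contra_notN Aw => /eqP d0; rewrite wE d0 !scale0r addr0.
  exists d^-1; rewrite wE scalerDr scalerA -algM mulVf // !scale1r opprD.
  by rewrite addrCA subrr addr0; apply/AN/AZ0.
have uniq_coord v c d : A (v - c%:A *: w) -> A (v - d%:A *: w) -> c = d.
  move=> Ac /AN Ad; apply/eqP; rewrite -subr_eq0; apply: contra_notT Aw => cd.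
  have := AZ0 (d - c)^-1 _ (AD _ _ Ac Ad).
  have -> : v - c%:A *: w - (v - d%:A *: w) = (d - c)%:A *: w.
    by rewrite algB scalerBl opprB addrC addrA subrK.
  by rewrite scalerA -algM mulVf ?scale1r // -opprB oppr_eq0.
have [lam lamP] := choice coord; exists lam; split.
- move=> u v; apply: (uniq_coord (u + v)); first exact: lamP.
  by rewrite algD scalerDl opprD addrACA; apply: AD.
- move=> c v; apply: (uniq_coord (c%:A *: v)); first exact: lamP.
  by rewrite algM -scalerA -scalerBr; apply: AZ0.
- apply: (uniq_coord w); first exact: lamP.
  by rewrite !scale1r subrr.
Qed.

Section TruncatedPolynomial.
Variables (k : fieldType) (R : comAlgType k) (G : nat -> {pred R}).
Hypothesis hG : standard_graded G.
Hypothesis R0_k : forall x : R, x \in G 0%N <-> exists c : k, x = c%:A.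
Variable x : R.
Hypothesis xG : x \in G 1%N.
Hypothesis xgen : generates x.

Lemma power_degree n : x ^+ n \in G n.
Proof. by rewrite -[X in G X]mul1n graded_exp. Qed.

Lemma horner_alg_principal (p : {poly k}) n :
  (forall i, (i < n)%N -> p`_i *: x ^+ i = 0) ->
  horner_alg x p \in principal_ideal (x ^+ n).
Proof.
move=> p0; rewrite horner_algE.
apply: rpred_sum => i _; have [/p0 ->|ni] := ltnP i n; first exact: rpred0.
by rewrite -(subnK ni) exprD scalerAl; apply/principal_idealP; eexists.
Qed.

Variable M : graded_module G.
Local Notation prM := (proj (gm_direct M)).

Section Splitting.
Variables (e : nat) (a : int) (u : M).
Hypothesis xeM : forall v : M, x ^+ e.+1 *: v = 0.
Hypothesis ua : u \in gm_comp M a.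
Hypothesis xeu : x ^+ e *: u != 0.

(** Homogeneity of [u] reduces the claim to the terms [p`_i *: x ^+ i] of [r],
    and a term with [i <= e] that kills [u] has coefficient 0. *)
Lemma cyclic_annihilator r : r *: u = 0 -> r \in principal_ideal (x ^+ e.+1).
Proof.
have [p rE] := xgen r; rewrite rE => ru.
apply: horner_alg_principal => i ie.
have : (p`_i *: x ^+ i) *: u = 0.
  have := proj_scale_hom hG (i%:Z + a) r ua.
  by rewrite rE ru raddf0 addrK proj_horner_alg.
move/eqP; rewrite -[p`_i *: _]mulr_algl -scalerA.
have [->|pi0 /eqP piu] := eqVneq p`_i 0; first by rewrite scale0r mul0r.
case/eqP: xeu; rewrite -[e](subnK (ie : (i <= e)%N)) exprD -scalerA.
have -> : x ^+ i *: u = ((p`_i)^-1)%:A *: ((p`_i)%:A *: (x ^+ i *: u)).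
  have algM (c d : k) (w : M) : c%:A *: (d%:A *: w) = (c * d)%:A *: w.
    by rewrite scalerA mulr_algl scalerA.
  by rewrite algM mulVf // !scale1r.
by rewrite piu !scaler0.
Qed.

(** Let [lam] be a functional with value 1 at the socle generator [x ^+ e *: u]
    of [R u], and let [j] be the degree of this element.  The kernel of [lam]
    composed with the projection to degree [j] contains a largest submodule [N],
    which is graded and meets [R u] trivially.  For [i, l <= e] the value
    [mu i (x ^+ l *: u)] is 1 if [i + l = e] and 0 otherwise; this antidiagonal
    system is solved by the coefficients [mu (e - l) v], and subtracting the
    corresponding multiple of [u] moves [v] into [N]. *)
Lemma cyclic_summand : exists N : {pred M},
  [/\ graded_submodule N, forall v r, v = r *: u -> v \in N -> v = 0
    & forall v, exists r n, n \in N /\ v = r *: u + n].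
Proof.
have [lam [lamD lamZ lam1]] := exists_functional xeu.
have lam0 : lam 0 = 0 by have := lamZ 0 0; rewrite scaler0 mul0r.
pose j : int := e%:Z + a.
pose mu i v := lam (prM j (x ^+ i *: v)).
have muD i v v' : mu i (v + v') = mu i v + mu i v'.
  by rewrite /mu scalerDr raddfD lamD.
have muZ i (c : k) v : mu i (c%:A *: v) = c * mu i v.
  rewrite /mu scalerA mulrC -scalerA (@proj_hom_scale _ _ M 0) ?subr0 ?lamZ //.
  by apply/R0_k; exists c.
have mu0 i : mu i 0 = 0 by rewrite /mu scaler0 raddf0.
have muX i l v : mu i (x ^+ l *: v) = mu (i + l)%N v.
  by rewrite /mu scalerA -exprD.
have mu_sum i n (c : nat -> k) (v : nat -> M) :
    mu i (\sum_(l < n) (c l)%:A *: v l) = \sum_(l < n) c l * mu i (v l).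
  elim: n => [|n IHn]; first by rewrite !big_ord0.
  by rewrite !big_ord_recr /= muD muZ IHn.
have mu_hom i s v : v \in gm_comp M s ->
    mu i v = if i%:Z + s == j then lam (x ^+ i *: v) else 0.
  move=> vs; have /(proj_hom (gm_direct M) j) E := gm_scale (power_degree i) vs.
  by rewrite /mu E eq_sym; case: ifP; rewrite ?lam0.
(* Degrees decide all cases but [i + l = e], where [lam] takes the value 1. *)
have mu_u i l : mu i (x ^+ l *: u) = (i + l == e)%N%:R.
  rewrite muX (mu_hom _ _ _ ua) (inj_eq (addIr a)) eqz_nat.
  by case: eqP => [->|].
have mu_proj i s v : i%:Z + s = j -> mu i (prM s v) = mu i v.
  move=> isj; rewrite /mu !(proj_hom_scale _ _ (power_degree i)) -isj.
  by rewrite addrC addKr (proj_id _ (proj_in _ _ _)).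
pose N : {pred M} := set_pred [set v | forall i, mu i v = 0].
exists N; split.
- split.
    split; first by apply/set_predP => i; exact: mu0.
    move=> r v v' /set_predP vN /set_predP vN'; apply/set_predP => i.
    have [p ->] := xgen r; rewrite muD vN' addr0 horner_algE scaler_suml.
    under eq_bigr => l _ do rewrite -mulr_algl -scalerA.
    rewrite (mu_sum i _ (fun l => p`_l) (fun l => x ^+ l *: v)) big1 // => l _.
    by rewrite muX vN mulr0.
  move=> s f us fM /set_predP fN t ts; apply/set_predP => i.
  rewrite (mu_hom i t (f t)) //; case: eqP => // itj.
  have <- := fN i; rewrite -(mu_proj i t) // (proj_sum _ t us) // ts.
  by rewrite (mu_hom i t) // itj eqxx.
- move=> v r -> /set_predP rN.
  suff /principal_idealP[q ->] : r \in principal_ideal (x ^+ e.+1).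
    by rewrite -scalerA xeM scaler0.
  have [p rE] := xgen r; rewrite rE in rN *.
  apply: horner_alg_principal => i ie.
  have := rN (e - i)%N; rewrite horner_algE scaler_suml.
  under eq_bigr => l _ do rewrite -mulr_algl -scalerA.
  rewrite (mu_sum _ _ (fun l => p`_l) (fun l => x ^+ l *: u)).
  have [ip|pi] := ltnP i (size p); last by rewrite (nth_default _ pi) scale0r.
  rewrite (bigD1 (Ordinal ip)) //= mu_u subnK // eqxx mulr1 big1 ?addr0.
    by move=> ->; rewrite scale0r.
  move=> l li; rewrite mu_u [(_ + _ == _)%N]negbTE ?mulr0 //.
  apply: contra_neq li => il; apply: val_inj; apply: (@addnI (e - i)%N).
  by rewrite /= il subnK.
- move=> v; pose r := \sum_(l < e.+1) (mu (e - l)%N v)%:A * x ^+ l.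
  exists r, (v - r *: u); split; last by rewrite addrC subrK.
  apply/set_predP => i; rewrite muD -scaleN1r -(scale1r (1 : R)) -scaleNr muZ.
  rewrite mulN1r scaler_suml; under eq_bigr => l _ do rewrite -scalerA.
  rewrite (mu_sum i _ (fun l => mu (e - l)%N v) (fun l => x ^+ l *: u)).
  apply/eqP; rewrite subr_eq0; apply/eqP.
  have [ie|ei] := leqP i e.
    have le : (e - i < e.+1)%N by rewrite ltnS leq_subr.
    rewrite (bigD1 (Ordinal le)) //= mu_u subnKC // eqxx mulr1 subKn //.
    rewrite big1 ?addr0 // => l li.
    rewrite mu_u [(_ + _ == _)%N]negbTE ?mulr0 //.
    apply: contra_neq li => il; apply: val_inj.
    by rewrite /= -[LHS](addKn i) il.
  rewrite big1 => [|l _].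
    by rewrite /mu -(subnK ei) exprD -scalerA xeM scaler0 raddf0 lam0.
  by rewrite mu_u gtn_eqF ?mulr0 // ltn_addr.
Qed.

Lemma indecomposable_cyclic : gm_indecomposable M ->
  forall v : M, exists r, v = r *: u.
Proof.
move=> [_ indec]; have [N [Ngr NU NUM]] := cyclic_summand.
pose U : {pred M} := set_pred [set v | exists r, v = r *: u].
have Ugr : graded_submodule U.
  split.
    split; first by apply/set_predP; exists 0; rewrite scale0r.
    move=> r _ _ /set_predP[s ->] /set_predP[t ->]; apply/set_predP.
    by exists (r * s + t); rewrite scalerDl scalerA.
  move=> s f us fM /set_predP[r fr] i si; apply/set_predP.
  have := proj_sum (gm_direct M) i us fM; rewrite fr si => <-.
  by rewrite (proj_scale_hom hG _ _ ua); eexists.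
have [||U0|N0] := indec U N Ugr Ngr.
- move=> v; have [r [n [nN ->]]] := NUM v; exists (r *: u), n; split=> //.
  by apply/set_predP; exists r.
- by move=> v /set_predP[r vE] vN; apply: (NU v r).
- have /eqP := U0 (x ^+ e *: u) (introT (set_predP _ _) (ex_intro _ _ erefl)).
  by rewrite (negPf xeu).
by move=> v; have [r [n [/N0 -> ->]]] := NUM v; exists r; rewrite addr0.
Qed.

End Splitting.

Lemma indecomposable_quotient N : x ^+ N = 0 -> gm_indecomposable M ->
  exists i : 'I_N, gm_shift_iso M (graded_quotient hG (power_degree i.+1)).
Proof.
move=> xN indec; have [[v0 v00] _] := indec.
have ex : exists n, `[< forall v : M, x ^+ n *: v = 0 >].
  by exists N; apply/asboolP => v; rewrite xN scale0r.
case: (ex_minnP ex) => -[|e] /asboolP xeM emin.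
  by case/eqP: v00; rewrite -[v0]scale1r -(expr0 x).
have eN : (e < N)%N by apply: emin; apply/asboolP => v; rewrite xN scale0r.
have [v xev] : exists v : M, x ^+ e *: v != 0.
  apply: contrapT => nv; suff : (e < e)%N by rewrite ltnn.
  apply: emin; apply/asboolP => v; apply: contrapT => /eqP xv.
  by apply: nv; exists v.
have [a xeu] : exists a, x ^+ e *: prM a v != 0.
  apply: contrapT => na; case/eqP: xev.
  have [s _ ->] := sum_proj (gm_direct M) v; rewrite scaler_sumr big1 // => i _.
  by apply: contrapT => /eqP xi; apply: na; exists i.
have ua := proj_in (gm_direct M) a v.
have cyc := indecomposable_cyclic xeM ua xeu indec.
exists (Ordinal eN); apply: (cyclic_shift_iso hG ua cyc) => r; split.
  exact: (cyclic_annihilator ua xeu).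
by move=> /principal_idealP[q ->]; rewrite -scalerA xeM scaler0.
Qed.

End TruncatedPolynomial.

Lemma generator_finite_type (k : fieldType) (R : comAlgType k)
    (G : nat -> {pred R}) (x : R) N : standard_graded G ->
  (forall y : R, y \in G 0%N <-> exists c : k, y = c%:A) -> krull_dim R 0 ->
  x \in G 1%N -> generates x -> x ^+ N = 0 -> graded_finite_CM_type G.
Proof.
move=> hG R0_k dim0 xG xgen xN.
exists 'I_N, (fun i : 'I_N => graded_quotient hG (power_degree hG xG i.+1)).
split.
  by move=> i; exact: graded_quotient_mcm.
by move=> M indec _; exact: indecomposable_quotient.
Qed.

Theorem proposition2p1 (k : closedFieldType) (R : comAlgType k)
    (G : nat -> {pred R})
    (k_char0 : [pchar k] =i pred0)
    (k_uncountable : ~ countable [set: k])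
    (R_graded : standard_graded G)
    (R0_k : forall x : R, x \in G 0%N <-> exists c : k, x = c%:A)
    (R_dim0 : krull_dim R 0)
    (R_CM : cohen_macaulay G) :
  [<-> graded_finite_CM_type G;
       graded_countable_CM_type G;
       hypersurface G].
Proof.
split=> [[I [F FI]]|]; first by exists I, F.
split=> [ctype|hyp].
  have [x xG xgen] :=
    countable_type_generator R_graded R0_k k_uncountable R_dim0 ctype.
  have [N xN] := homogeneous_nilpotent R_graded R_dim0 xG isT.
  exact: (generator_hypersurface R_graded R0_k xG xgen xN).
have [x xG xgen] := hypersurface_generator R_graded R_dim0 hyp.
have [N xN] := homogeneous_nilpotent R_graded R_dim0 xG isT.
exact: (generator_finite_type R_graded R0_k R_dim0 xG xgen xN).
Qed.
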